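(* Let $n=p_1^{\alpha_1}p_2^{\alpha_2}\cdots p_r^{\alpha_r}$, where $r\geq 2$, $\alpha_1,\ldots,\alpha_r$ are positive integers and $p_1<p_2<\cdots<p_r$ are primes. Suppose that at least one of the following holds: (i) $2\phi(p_1p_2\cdots p_r)\geq p_1p_2\cdots p_r$; (ii) $\phi(p_{i+1})\geq r\,\phi(p_i)$ for each $i\in\{1,2,\ldots,r-1\}$. Let $t\in\{2,3,\ldots,r\}$ be the largest integer such that $\alpha_t\geq\alpha_j$ for all $2\leq j\leq r$. Then $$\delta(\mathcal{P}(C_n))=\min\{\deg(p_s^{\alpha_s}) : t\leq s\leq r\}.$$
   Context: For a finite group $G$, the power graph $\mathcal{P}(G)$ is the simple undirected graph with vertex set $G$ in which two distinct vertices are adjacent if one is an integral power of the other. $C_n$ denotes the cyclic group of order $n$, identified with $\mathbb{Z}_n=\{0,1,\ldots,n-1\}$, so a positive divisor $d<n$ of $n$ is regarded as the element $d\in\mathbb{Z}_n$. $\deg(a)$ is the degree of vertex $a$ in $\mathcal{P}(C_n)$, $\delta$ denotes minimum degree, and $\phi$ is Euler's totient function. *)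

(* Defs.v *)
From mathcomp Require Import all_boot all_order all_algebra all_fingroup.
Set Implicit Arguments. Unset Strict Implicit. Unset Printing Implicit Defensive.

Local Open Scope group_scope.

Definition pg_adj (gT : finGroupType) (x y : gT) : bool :=
  (x != y) && ((y \in <[x]>) || (x \in <[y]>)).

Definition pg_deg (gT : finGroupType) (x : gT) : nat :=
  #|[set y : gT | pg_adj x y]|.

Definition pg_mindeg (gT : finGroupType) : nat :=
  \big[minn/#|gT|]_(x : gT) pg_deg x.

(* Main.v *)
(* An element of order m = \prod_i p_i ^ b_i of C_n has a closed neighbourhood of
   size D(b) = m - phi(m) + \prod_i S_i, where S_i is the number of elements of
   C_(p_i ^ a_i) whose order is divisible by p_i ^ b_i. Either hypothesis gives
     p_1 ... p_r <= (p_i + p_j) \prod_(k != i) (p_k - 1)   for i < j,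
   and this forces D not to increase when b_i is raised to a_i while b_j < a_j
   for some j > i. Raising all coordinates but the last deficient one, and then
   setting that one to 0, reduces the minimum to the r elements p_s ^ a_s. Two of
   these are compared directly; only s = 1 with p_1 ^ a_1 > p_t ^ a_t needs more
   than p_s < p_t, namely the inequality above when a_t > 1, and otherwise
   \prod_(k > 1) (p_k - 1) >= \prod_(k < r) p_k, as then t = r. *)

Require Import Defs.
From mathcomp Require Import all_boot all_order all_algebra all_fingroup.
From mathcomp Require Import cyclic zify ring.

Set Implicit Arguments.
Unset Strict Implicit.
Unset Printing Implicit Defensive.

(** * Neighbourhoods in the power graph of a cyclic group *)

Lemma mem_cycle_dvd (gT : finGroupType) (x y : gT) :
  cyclic [set: gT] -> (x \in <[y]>%g) = (#[x]%g %| #[y]%g).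
Proof.
by move=> cT; rewrite !orderE (cardSg_cyclic cT) ?subsetT // cycle_subG.
Qed.

(** Inclusion-exclusion: the closed neighbourhood of [x] is the union of [<[x]>] and the elements of
    order divisible by that of [x], and these two sets meet in the generators of [<[x]>]. *)
Lemma pg_degE (gT : finGroupType) (x : gT) : cyclic [set: gT] ->
  (pg_deg x).+1 + totient #[x]%g = #[x]%g + #|[set y : gT | #[x]%g %| #[y]%g]|.
Proof.
move=> cT; set B := [set y | _].
have -> : (pg_deg x).+1 = #|<[x]>%g :|: B|.
  rewrite /pg_deg (cardsD1 x (<[x]>%g :|: B)) inE cycle_id /=.
  rewrite add1n; congr (_.+1); apply: eq_card => y.
  by rewrite !inE /pg_adj eq_sym -(mem_cycle_dvd _ _ cT).
rewrite totient_gen -[#[x]%g in RHS]/#|<[x]>%g| -[RHS]cardsUI; congr (_ + _).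
apply: eq_card => y; rewrite !inE /generator -(mem_cycle_dvd _ _ cT).
by rewrite eqEsubset !cycle_subG; apply: andbC.
Qed.

Lemma cyclic_Zn n : cyclic [set: 'Z_n].
Proof. by apply/cyclicP; exists Zp1; rewrite Zp_cycle. Qed.

Lemma order_Zn n (x : 'Z_n) : 1 < n -> #[x]%g = n %/ gcdn n x.
Proof.
move=> n1; rewrite -[in LHS](Zp1_expgz x) orderXgcd order_Zp1.
by move: (nat_of_ord x) => y; rewrite Zp_cast.
Qed.

(** * Counting residues by the Chinese remainder theorem *)

Lemma sum_crt q N (P Q : nat -> nat) : coprime q N -> 0 < q -> 0 < N ->
  (forall y, P (y %% q) = P y) -> (forall y, Q (y %% N) = Q y) ->
  \sum_(y < q * N) P y * Q y = (\sum_(y < q) P y) * (\sum_(y < N) Q y).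
Proof.
move=> co q0 N0 hP hQ; rewrite big_distrlr pair_big /=.
pose f (y : 'I_(q * N)) : 'I_q * 'I_N :=
  (Ordinal (ltn_pmod y q0), Ordinal (ltn_pmod y N0)).
have f_inj : injective f.
  move=> x y [] /eqP e1 /eqP e2; apply/val_inj/eqP => /=.
  rewrite -(modn_small (ltn_ord x)) -(modn_small (ltn_ord y)) /=.
  by rewrite chinese_remainder // e1 e2.
rewrite (reindex f) /=; first by apply: eq_bigr => y _; rewrite hP hQ.
by apply/onW_bij/inj_card_bij => //; rewrite card_prod !card_ord.
Qed.

Lemma sum_prod_crt (I : eqType) (s : seq I) (q : I -> nat) (T : I -> nat -> nat) :
  uniq s -> (forall i, 0 < q i) ->
  (forall i j, i != j -> coprime (q i) (q j)) ->
  (forall i y, T i (y %% q i) = T i y) ->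
  \sum_(y < \prod_(i <- s) q i) \prod_(i <- s) T i y =
  \prod_(i <- s) \sum_(y < q i) T i y.
Proof.
move=> + q0 co hT; elim: s => [|i s IH] /=; first by rewrite !big_nil big_ord1 big_nil.
case/andP => nis us; rewrite !big_cons -IH //.
under eq_bigr do rewrite big_cons.
have h y : \prod_(j <- s) T j (y %% \prod_(k <- s) q k) = \prod_(j <- s) T j y.
  apply: eq_big_seq => j js.
  have dj : q j %| \prod_(k <- s) q k by rewrite (big_rem j) //= dvdn_mulr.
  by rewrite -[LHS]hT modn_dvdm // hT.
apply: (@sum_crt _ _ (T i) (fun y => \prod_(j <- s) T j y)) => //.
  rewrite big_seq; elim/big_ind: _ => [|? ? ? ?|j js]; rewrite ?coprimen1 ?coprimeMr //.
    exact/andP.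
  by apply: co; apply: contraNneq nis => ->.
by rewrite prodn_gt0.
Qed.

(* The number of elements of order divisible by p ^ b in a cyclic group of order p ^ a. *)
Definition above p a b := if b is b'.+1 then p ^ a - p ^ b' else p ^ a.

Lemma sum_dvd d k : 0 < d -> \sum_(y < d * k) (d %| y) = k.
Proof.
move=> d0; rewrite -(big_mkord xpredT (fun y => (d %| y) : nat)).
case: k => [|k]; first by rewrite muln0 big_geq.
have h : 0 < d * k.+1 by rewrite muln_gt0 d0.
(* The known count runs from 1 to the top value included; the multiples at the two ends are
   exchanged. *)
have := divn_count_dvd d (d * k.+1); rewrite mulKn // big_nat_recr //= dvdn_mulr // => e.
by rewrite big_ltn // dvdn0 [in RHS]e addnC.
Qed.

(** For b > 0, exactly p^(b-1) of the p^a residues are multiples of p^(a-b+1), and these are the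
    ones removed. *)
Lemma sum_above p a b : prime p -> b <= a ->
  \sum_(y < p ^ a) ((b == 0) || ~~ (p ^ (a - b).+1 %| y) : nat) = above p a b.
Proof.
move=> pp; case: b => [_|b ba] /=; first by rewrite sum_nat_const card_ord muln1.
have p0 : 0 < p ^ (a - b.+1).+1 by rewrite expn_gt0 prime_gt0.
have ea : p ^ a = p ^ (a - b.+1).+1 * p ^ b by rewrite -expnD; congr (_ ^ _); lia.
have := sum_dvd (p ^ b) p0; rewrite -ea => h; rewrite -h.
apply/eqP; rewrite -(eqn_add2r (\sum_(y < p ^ a) (p ^ (a - b.+1).+1 %| y))) subnK; last first.
  by rewrite h leq_exp2l ?prime_gt1 // ltnW.
rewrite -big_split (eq_bigr (fun=> 1)) ?sum_nat_const ?card_ord ?muln1 //=.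
by move=> y _; case: (_ %| _).
Qed.

(** The quotient is the order of y in ['Z_n]. Its p-adic valuation is a minus that of the gcd, so it
    reaches b > 0 iff the gcd has valuation at most a - b; as a - b + 1 <= a, this can be read off y
    itself. *)
Lemma pow_dvd_div_gcd p a b n y : prime p -> 0 < n -> b <= a -> logn p n = a ->
  (p ^ b %| n %/ gcdn n y) = (b == 0) || ~~ (p ^ (a - b).+1 %| y).
Proof.
move=> pp n0 ba ea; have g0 : 0 < gcdn n y by rewrite gcdn_gt0 n0.
case: b ba => [|b] ba; first by rewrite dvd1n.
have h0 : 0 < n %/ gcdn n y by rewrite divn_gt0 // dvdn_leq ?dvdn_gcdl.
have -> : (p ^ (a - b.+1).+1 %| y) = (p ^ (a - b.+1).+1 %| gcdn n y).
  rewrite dvdn_gcd [X in _ = X && _](_ : _ = true) //.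
  by rewrite pfactor_dvdn // ea; lia.
rewrite !pfactor_dvdn // logn_div ?dvdn_gcdl // ea /=.
have : logn p (gcdn n y) <= a by rewrite -ea dvdn_leq_log ?dvdn_gcdl.
lia.
Qed.


(** * Estimates at a single prime *)

Lemma pow_predE p b : 0 < b -> p ^ b = p * p ^ b.-1.
Proof. by case: b => // b _; rewrite expnS. Qed.

Lemma totient_pow_le p b : prime p -> totient (p ^ b) <= p ^ b.
Proof.
move=> pp; case: b => // b; rewrite totient_pfactor //= expnS.
by rewrite leq_mul2r leq_pred orbT.
Qed.

Lemma totient_pow_rad p b : prime p -> 0 < b -> p * totient (p ^ b) = p.-1 * p ^ b.
Proof.
by move=> pp; case: b => // b _; rewrite totient_pfactor //= expnS mulnCA.
Qed.

Lemma totient_pow_rad_le p b : prime p -> p.-1 * p ^ b <= p * totient (p ^ b).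
Proof.
move=> pp; case: (posnP b) => [->|b0]; last by rewrite totient_pow_rad.
by rewrite !muln1 leq_pred.
Qed.

Lemma above_full p a : prime p -> 0 < a -> above p a a = totient (p ^ a).
Proof.
move=> pp; case: a => // a _; rewrite totient_pfactor //= expnS.
by rewrite -{2}[p ^ a]mul1n -mulnBl subn1.
Qed.

Lemma above_rad_le p a b : prime p -> b <= a -> p.-1 * p ^ b <= p * above p a b.
Proof.
move=> pp; case: b => [|b] ba /=.
  by rewrite muln1; have : 0 < p ^ a by [rewrite expn_gt0 prime_gt0]; nia.
have : p ^ b.+1 <= p ^ a by rewrite leq_exp2l ?prime_gt1.
rewrite expnS; have := prime_gt1 pp; nia.
Qed.

(** Deficiency b < a gives, for b > 0, [above p a b] >= p^(b+1) - p^(b-1), and adding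
    (c-1)(p-1)p^(b-1) yields p^(b-1) (p-1) (p+c). In use, c is the prime whose exponent is being
    raised. *)
Lemma above_totient_ge p a b c : prime p -> b < a -> 0 < c ->
  p ^ b * ((c + p) * p.-1) <= p * (above p a b + c.-1 * totient (p ^ b)).
Proof.
move=> pp; have p1 := prime_gt1 pp; case: b => [|b] ba c0 /=.
  have : p ^ 1 <= p ^ a by rewrite leq_exp2l.
  rewrite expn1 mul1n muln1; nia.
have : p ^ b.+2 <= p ^ a by rewrite leq_exp2l.
rewrite totient_pfactor //= !expnS; move: (p ^ b) (p ^ a) => x q.
case: p pp p1 => [|u] // _ u1; case: c c0 => [|c] // _; rewrite /= => h.
have : u.+1 * (u.+1 * (u.+1 * x)) <= u.+1 * q by rewrite leq_mul2l h.
nia.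
Qed.

(* The size of a closed neighbourhood is affine in p ^ b.-1 for b > 0, with
   nonpositive slope here. *)
Lemma raise_coord p a b M F A : prime p -> b <= a -> 0 < a -> F <= M ->
  p * M <= A + p.-1 * F ->
  p ^ a * M + above p a a * A - totient (p ^ a) * F <=
  p ^ b * M + above p a b * A - totient (p ^ b) * F.
Proof.
move=> pp; have p1 := prime_gt1 pp.
case: a => // a; case: b => [|b] ba _ FM h.
  rewrite /above totient_pfactor //= expnS expn0 (_ : totient 1 = 1) // !mul1n.
  move: (p ^ a) => y; case: p pp p1 h => [|u] // _ u1 h; rewrite /= in h *.
  have : y * (u.+1 * M) <= y * (A + u * F) by rewrite leq_mul2l h orbT.
  nia.
have : p ^ b <= p ^ a by rewrite leq_exp2l.
rewrite /above !totient_pfactor //= !expnS.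
move: (p ^ a) (p ^ b) => y x xy; have -> : y = x + (y - x) by lia.
move: (y - x) => z {xy y}.
case: p pp p1 h => [|u] // _ u1 h; rewrite /= in h *.
have : z * (u.+1 * M) <= z * (A + u * F) by rewrite leq_mul2l h orbT.
have : (x + z) * u * F <= (x + z) * u * M by rewrite leq_mul2l FM orbT.
have : x * u * F <= x * u * M by rewrite leq_mul2l FM orbT.
nia.
Qed.

(** For b > 0 the right side collapses to p^b (M - F) + p^a F, while the left is (M - F) + p^a F. *)
Lemma zero_coord p a b M F : prime p -> b <= a -> F <= M ->
  M + p ^ a * F - F <= p ^ b * M + above p a b * F - totient (p ^ b) * F.
Proof.
move=> pp; have p1 := prime_gt1 pp; case: b => [|b] ba FM.
  by rewrite /= expn0 (_ : totient 1 = 1) // !mul1n.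
have : p ^ b.+1 <= p ^ a by rewrite leq_exp2l.
have : 0 < p ^ b by rewrite expn_gt0 ltnW.
rewrite /above totient_pfactor //= expnS.
move: (p ^ a) (p ^ b) => q x x0; case: p pp p1 => [|u] // _ u1 /= h.
have -> : M = F + (M - F) by lia.
move: (M - F) => d; have -> : q = u.+1 * x + (q - u.+1 * x) by lia.
move: (q - _) => e; case: x x0 h => // x _ _. nia.
Qed.

(** * Arithmetic for comparing the neighbourhoods of two elements p_s^a_s and p_t^a_t *)

Lemma leq_sub_cross A B C D : D <= C -> A + D <= C + B -> A - B <= C - D.
Proof. lia. Qed.

(** Reduces a nonlinear inequality to a [ring] identity by exhibiting X - Y as a known slack t -
    s. *)
Lemma leq_of_excess X Y s t : X + s = Y + t -> s <= t -> Y <= X.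
Proof. lia. Qed.

(** Here p_s = u+1 and p_t = u+v+2, which encodes p_s < p_t without subtraction; x and y are
    p_s^(a_s-1) and p_t^(a_t-1). With P = p_s x and Q = p_t y, right minus left is (Q - P)(N - F) +
    ((v+1)xy + y - x)F, and the hypothesis says that this is nonnegative. *)
Lemma nbhd_cmp u v x y N F : 0 < x ->
  u.+1 * x * N + (u + v).+2 * y * F + x * F <=
  (u + v).+2 * y * N + u.+1 * x * F + v.+1 * (x * y * F) + y * F ->
  u.+1 * x * N + (u + v).+2 * y * (u * x * F) - u * x * F <=
  (u + v).+2 * y * N + u.+1 * x * ((u + v).+1 * y * F) - (u + v).+1 * y * F.
Proof.
move=> x0 h; apply: leq_sub_cross.
  by apply: leq_trans (leq_addl _ _); rewrite leq_pmull // muln_gt0.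
apply: leq_of_excess h; clear. ring.
Qed.

Lemma nbhd_cmp_small u v x y N F : 0 < x -> 0 < y -> u.+1 * x <= (u + v).+2 * y ->
  F <= N ->
  u.+1 * x * N + (u + v).+2 * y * (u * x * F) - u * x * F <=
  (u + v).+2 * y * N + u.+1 * x * ((u + v).+1 * y * F) - (u + v).+1 * y * F.
Proof.
move=> x0 y0 h /subnKC <-; apply: nbhd_cmp => //.
have h1 : (N - F) * (u.+1 * x) <= (N - F) * ((u + v).+2 * y) by rewrite leq_mul2l h orbT.
have h2 : x * F <= x * F * y by rewrite leq_pmulr.
apply: leq_of_excess (leq_trans (leq_add h1 h2) (leq_addr (v * (x * F * y) + y * F) _)).
clear. ring.
Qed.

(** Now (Q - P)(N - F) is a loss. After scaling by p_s p_t, the last hypothesis bounds the N term; w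
    = P - Q <= p_s x and y >= p_t then let (v+1)xyF absorb the loss. *)
Lemma nbhd_cmp_large u v x y N F : 0 < x -> (u + v).+2 <= y -> (u + v).+2 * y <= u.+1 * x ->
  u.+1 * (u + v).+2 * N <= (u.+1 + (u + v).+2) * (u + v).+1 * F ->
  u.+1 * x * N + (u + v).+2 * y * (u * x * F) - u * x * F <=
  (u + v).+2 * y * N + u.+1 * x * ((u + v).+1 * y * F) - (u + v).+1 * y * F.
Proof.
move=> x0 Py h K; apply: nbhd_cmp => //.
move: (leq_subr ((u + v).+2 * y) (u.+1 * x)); rewrite -(subnKC h) [X in X - _]subnKC //.
move: (u.+1 * x - (u + v).+2 * y) (esym (subnKC h)) => w ew; rewrite -ew => wx.
have ep : 0 < u.+1 * (u + v).+2 by [].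
have K' : w * (u.+1 * (u + v).+2 * N) <= w * ((u.+1 + (u + v).+2) * (u + v).+1 * F).
  by rewrite leq_mul2l K orbT.
have h1 : w * (u + v).+2 * (u + v).+1 * F <= u.+1 * x * (u + v).+2 * (u + v).+1 * F.
  by rewrite !leq_mul.
have h2 : u.+1 * (u + v).+2 * x * (u + v).+2 * F <= u.+1 * (u + v).+2 * x * y * F.
  by rewrite !leq_mul.
rewrite -(leq_pmul2l ep).
suff : u.+1 * (u + v).+2 * (w * N + x * F) <=
  u.+1 * (u + v).+2 * (w * F + v.+1 * (x * y * F) + y * F).
  rewrite !leq_pmul2l // => H; rewrite ew.
  apply: leq_of_excess H; clear. ring.
have h3 := leq_add (leq_add K' h1) h2.
apply: leq_of_excess (leq_trans h3 (leq_addr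
  (w * u.+1 * F + u.+1 * (u + v).+2 * (y + v * (x * y)) * F) _)).
clear. ring.
Qed.

(** With y = 1 the excess is x - 1 times the slack of the hypothesis, plus (v+1)N. *)
Lemma nbhd_cmp_one u v x N F : 0 < x -> 
  u.+1 * N <= (u + v).+1 * F ->
  u.+1 * x * N + (u + v).+2 * (u * x * F) - u * x * F <=
  (u + v).+2 * N + u.+1 * x * ((u + v).+1 * F) - (u + v).+1 * F.
Proof.
case: x => // x _ K.
have := @nbhd_cmp u v x.+1 1 N F isT; rewrite !muln1; apply.
have h1 : x * (u.+1 * N) <= x * ((u + v).+1 * F) by rewrite leq_mul2l K orbT.
apply: leq_of_excess (leq_trans h1 (leq_addr (v.+1 * N) _)).
clear. ring.
Qed.

(** Bernoulli's inequality with denominators cleared: m factors 1 - 1/p_k with p_k >= N have product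
    at least 1 - m/N. Truncated subtraction makes it trivial once m >= N. *)
Lemma bernoulli_pred (I : Type) (s : seq I) (P : pred I) (p : I -> nat) N :
  (forall k, P k -> N <= p k) ->
  (N - count P s) * \prod_(k <- s | P k) p k <= N * \prod_(k <- s | P k) (p k).-1.
Proof.
move=> hN; elim: s => [|i s IH]; first by rewrite !big_nil subn0.
rewrite !big_cons /=; case: ifPn => [Pi|_]; last by rewrite add0n.
move: IH (hN i Pi).
move: (count P s) (\prod_(k <- s | P k) _) (\prod_(k <- s | P k) _) => c B A.
move: (p i) => q IH Nq; case: (leqP N c) => cN.
  by rewrite (eqP (_ : N - (_ + c) == 0)) // subn_eq0 add1n leqW.
have -> : N - (1 + c) = (N - c).-1 by lia.
have h : (N - c).-1 * q <= (N - c) * q.-1.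
  move: cN Nq; clear; case: q => [|q]; first lia.
  move=> cN Nq; rewrite -(prednK (_ : 0 < N - c)) /=; last lia.
  rewrite mulnS mulSn; lia.
apply: (@leq_trans ((N - c) * q.-1 * A)); first by rewrite mulnA leq_mul2r h orbT.
by rewrite [N * _]mulnCA [_ * q.-1]mulnC -mulnA leq_mul2l IH orbT.
Qed.

(** * Degrees in terms of exponent vectors *)

Section Factored.

Variables (r : nat) (p a : 'I_r -> nat).
Hypothesis p_prime : forall i, prime (p i).
Hypothesis p_inj : injective p.

Let n := \prod_i p i ^ a i.

Lemma prod_pow_gt0 (b : 'I_r -> nat) : 0 < \prod_i p i ^ b i.
Proof. by rewrite prodn_gt0 // => i; rewrite expn_gt0 prime_gt0. Qed.

Lemma coprime_pows (b c : 'I_r -> nat) i j : i != j -> coprime (p i ^ b i) (p j ^ c j).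
Proof.
move=> ij; rewrite coprimeXl ?coprimeXr // prime_coprime // dvdn_prime2 //.
by rewrite (inj_eq p_inj).
Qed.

Lemma coprime_pow_prod (b c : 'I_r -> nat) (P : pred 'I_r) i :
  ~~ P i -> coprime (p i ^ b i) (\prod_(j | P j) p j ^ c j).
Proof.
move=> Pi; elim/big_ind: _ => [|? ? ? ?|j Pj]; rewrite ?coprimen1 ?coprimeMr //.
  exact/andP.
by apply: coprime_pows; apply: contraNneq Pi => ->.
Qed.

Lemma logn_prod_pow (b : 'I_r -> nat) i : logn (p i) (\prod_j p j ^ b j) = b i.
Proof.
rewrite (bigD1 i) //= lognM ?prodn_gt0 ?expn_gt0 ?prime_gt0 //; last first.
  by move=> j; rewrite expn_gt0 prime_gt0.
rewrite pfactorK // (_ : logn _ _ = 0) ?addn0 //; apply: logn_coprime.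
by have := @coprime_pow_prod (fun=> 1) b (fun j => j != i) i; rewrite eqxx expn1; apply.
Qed.

Lemma prod_pow_dvd (b : 'I_r -> nat) m : 
  (\prod_i p i ^ b i %| m) = [forall i, p i ^ b i %| m].
Proof.
have h (s : seq 'I_r) : uniq s -> 
    (\prod_(i <- s) p i ^ b i %| m) = all (fun i => p i ^ b i %| m) s.
  elim: s => [|i s IH] /=; first by rewrite big_nil dvd1n.
  case/andP=> nis us; rewrite big_cons Gauss_dvd ?IH //.
  rewrite big_uniq //=; exact: coprime_pow_prod.
rewrite h ?index_enum_uniq //; apply/allP/forallP => H i //.
by apply: H; rewrite mem_index_enum.
Qed.

Lemma dvd_prod_pow m : m %| n -> m = \prod_i p i ^ logn (p i) m.
Proof.
move=> mn; have m0 : 0 < m by rewrite (dvdn_gt0 (prod_pow_gt0 a)).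
apply/eqP; rewrite eqn_dvd prod_pow_dvd andbC; apply/andP; split.
  by apply/forallP => i; apply: pfactor_dvdnn.
apply/dvdn_partP => // q; rewrite mem_primes => /and3P[qp _ qm].
have : q %| n by apply: dvdn_trans mn.
rewrite [q %| n]Euclid_dvd_prod // big_orE => /existsP[i]; rewrite Euclid_dvdX // dvdn_prime2 //.
by case/and3P => _ /eqP -> _; rewrite p_part (bigD1 i) //= dvdn_mulr.
Qed.

Lemma totient_prod_pow (b : 'I_r -> nat) :
  totient (\prod_i p i ^ b i) = \prod_i totient (p i ^ b i).
Proof.
have h (s : seq 'I_r) : uniq s -> 
    totient (\prod_(i <- s) p i ^ b i) = \prod_(i <- s) totient (p i ^ b i).
  elim: s => [|i s IH] /=; first by rewrite !big_nil.
  case/andP=> nis us; rewrite !big_cons totient_coprime ?IH //.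
  rewrite big_uniq //=; exact: coprime_pow_prod.
by rewrite h ?index_enum_uniq.
Qed.

(* The size of the closed neighbourhood of an element of order \prod_i p i ^ b i. *)
Definition nbhd (b : 'I_r -> nat) :=
  \prod_i p i ^ b i + \prod_i above (p i) (a i) (b i) - \prod_i totient (p i ^ b i).

(** By [pg_degE] only the elements of order divisible by that of [x] remain to be counted. Their
    indicator is a product of local ones, the i-th periodic modulo p_i^a_i, so the count factors. *)
Lemma pg_deg_Zn m (b : 'I_r -> nat) (x : 'Z_m) : m = n -> 1 < m ->
  (forall i, b i <= a i) -> #[x]%g = \prod_i p i ^ b i -> (pg_deg x).+1 = nbhd b.
Proof.
move=> em; subst m => n1 ba ex; have := pg_degE x (cyclic_Zn n).
suff -> : #|[set y : 'Z_n | #[x]%g %| #[y]%g]| = \prod_i above (p i) (a i) (b i).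
  by rewrite ex /nbhd -totient_prod_pow => <-; rewrite addnK.
rewrite -sum1_card (eq_bigl (fun y : 'Z_n => #[x]%g %| #[y]%g)); last by move=> y; rewrite inE.
pose T i y : nat := (b i == 0) || ~~ (p i ^ (a i - b i).+1 %| y).
rewrite big_mkcond (eq_bigr (fun y : 'Z_n => \prod_i T i y)) /=; last first.
  move=> y _; rewrite ex order_Zn // prod_pow_dvd.
  case: ifPn => [/forallP H|].
    rewrite big1 // => i _; move: (H i).
    by rewrite (pow_dvd_div_gcd _ (p_prime i) (ltnW n1) (ba i) (logn_prod_pow a i)) /T => ->.
  rewrite negb_forall => /existsP[i]; rewrite (bigD1 i) //=.
  rewrite (pow_dvd_div_gcd _ (p_prime i) (ltnW n1) (ba i) (logn_prod_pow a i)) /T.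
  by move=> /negbTE ->.
rewrite -(big_mkord xpredT (fun y => \prod_i T i y)) Zp_cast // big_mkord.
rewrite /n sum_prod_crt ?index_enum_uniq //.
- by apply: eq_bigr => i _; apply: sum_above.
- by move=> i; rewrite expn_gt0 prime_gt0.
- by move=> i j; apply: coprime_pows.
move=> i y; rewrite /T; case: (posnP (b i)) => //= bi.
congr (nat_of_bool (~~ _)); rewrite /dvdn modn_dvdm // dvdn_exp2l //.
by have := ba i; lia.
Qed.

End Factored.

(** * Minimising the neighbourhood size over exponent vectors *)

Section Minimum.

Variables (r : nat) (p a : 'I_r -> nat).
Hypothesis p_prime : forall i, prime (p i).
Hypothesis a_gt0 : forall i, 0 < a i.

Let p_gt0 i : 0 < p i. Proof. exact: prime_gt0. Qed.

Lemma prod_rad_le (T : pred 'I_r) (f g : 'I_r -> nat) :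
  (forall i, T i -> (p i).-1 * f i <= p i * g i) ->
  (\prod_(i | T i) (p i).-1) * \prod_(i | T i) f i <=
  (\prod_(i | T i) p i) * \prod_(i | T i) g i.
Proof. by move=> h; rewrite -!big_split; apply: leq_prod. Qed.

Lemma totient_prod_rad (T : pred 'I_r) :
  (\prod_(i | T i) p i) * \prod_(i | T i) totient (p i ^ a i) =
  (\prod_(i | T i) (p i).-1) * \prod_(i | T i) p i ^ a i.
Proof. by rewrite -!big_split; apply: eq_bigr => i _; apply: totient_pow_rad. Qed.

(** The ratio of p^a to its totient does not depend on a > 0, so inequalities between radicals lift
    to prime powers. *)
Lemma rad_ineq (T : pred 'I_r) c d :
  c * \prod_(i | T i) p i <= d * \prod_(i | T i) (p i).-1 ->
  c * \prod_(i | T i) p i ^ a i <= d * \prod_(i | T i) totient (p i ^ a i).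
Proof.
move=> h; have P0 : 0 < \prod_(i | T i) p i by apply: prodn_gt0.
rewrite -(leq_pmul2l P0) [X in _ <= X]mulnCA totient_prod_rad !mulnA.
by rewrite [_ * c]mulnC leq_mul2r h orbT.
Qed.

Lemma prod_totient_le (T : pred 'I_r) (b : 'I_r -> nat) :
  \prod_(i | T i) totient (p i ^ b i) <= \prod_(i | T i) p i ^ b i.
Proof. by apply: leq_prod => i _; apply: totient_pow_le. Qed.

(** The common consequence of the two alternative hypotheses; p_i + p_j is the factor that a
    deficient coordinate j supplies through [above_totient_ge]. *)
Definition gap_condition := forall i j : 'I_r, i < j ->
  \prod_k p k <= (p i + p j) * \prod_(k | k != i) (p k).-1.

Lemma raise_nbhd (b b' : 'I_r -> nat) (i j : 'I_r) : gap_condition -> i < j ->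
  (forall k, b k <= a k) -> b j < a j ->
  (forall k, k != i -> b' k = b k) -> b' i = a i ->
  nbhd p a b' <= nbhd p a b.
Proof.
move=> K ij ba bj hb' b'i; rewrite /nbhd !(bigD1 i (P := xpredT)) //= b'i.
have ji : j != i by rewrite neq_ltn ij orbT.
have sub (g : 'I_r -> nat -> nat) :
  \prod_(k | k != i) g k (b' k) = \prod_(k | k != i) g k (b k).
  by apply: eq_bigr => k ki; rewrite hb'.
rewrite (sub (fun k c => p k ^ c)) (sub (fun k c => above (p k) (a k) c)).
rewrite (sub (fun k c => totient (p k ^ c))).
apply: raise_coord => //; first exact: prod_totient_le.
move: (K i j ij); rewrite (bigD1 i) //= !(bigD1 j (P := fun k => k != i)) //=.
have hA : (\prod_(k | (k != i) && (k != j)) (p k).-1) *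
  \prod_(k | (k != i) && (k != j)) p k ^ b k <=
  (\prod_(k | (k != i) && (k != j)) p k) * \prod_(k | (k != i) && (k != j)) above (p k) (a k) (b k).
  by apply: prod_rad_le => k _; apply: above_rad_le.
have hF : (\prod_(k | (k != i) && (k != j)) (p k).-1) *
  \prod_(k | (k != i) && (k != j)) p k ^ b k <=
  (\prod_(k | (k != i) && (k != j)) p k) * \prod_(k | (k != i) && (k != j)) totient (p k ^ b k).
  by apply: prod_rad_le => k _; apply: totient_pow_rad_le.
have hj := above_totient_ge (p_prime j) bj (p_gt0 i).
have P0 : 0 < \prod_(k | (k != i) && (k != j)) p k by apply: prodn_gt0.
move: (\prod_(k | (k != i) && (k != j)) p k) P0 hA hF => R R0.
move: (\prod_(k | (k != i) && (k != j)) (p k).-1) => Q.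
move: (\prod_(k | _) _) (\prod_(k | _) _) (\prod_(k | _) _) => F A M hA hF.
have pj := p_gt0 j; have pi := p_gt0 i.
move: (p j ^ b j) (totient _) (above _ _ _) hj => m f s hj KK.
(* This factor clears the denominators of the bounds [hA], [hF] and [hj], after which [KK] links
   them. *)
rewrite -(leq_pmul2l (_ : 0 < R * p j)) ?muln_gt0 ?R0 //.
apply: (@leq_trans (Q * M * (p j * (s + (p i).-1 * f)))).
  apply: (@leq_trans (Q * M * (m * ((p i + p j) * (p j).-1)))).
    move: KK => /(leq_mul (leqnn (m * M))) KK.
    by apply: leq_of_excess (leq_trans KK (leqnn _)); ring.
  by rewrite leq_mul2l hj orbT.
have h1 := leq_mul hA (leqnn (p j * s)).
have h2 := leq_mul hF (leqnn (p j * ((p i).-1 * f))).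
apply: leq_of_excess (leq_add h1 h2); ring.
Qed.

(** Exponent vector of n / p_j^a_j, the order of the element p_j^a_j of C_n. *)
Definition zero_at (j i : 'I_r) : nat := if i == j then 0 else a i.

Lemma nbhd_zero_at_le (b : 'I_r -> nat) j : (forall k, b k <= a k) ->
  (forall k, k != j -> b k = a k) -> nbhd p a (zero_at j) <= nbhd p a b.
Proof.
move=> ba hb; rewrite /nbhd !(bigD1 j (P := xpredT)) //= /zero_at eqxx.
have sub (g : 'I_r -> nat -> nat) :
    \prod_(k | k != j) g k (if k == j then 0 else a k) = \prod_(k | k != j) g k (a k).
  by apply: eq_bigr => k /negbTE ->.
have sub' (g : 'I_r -> nat -> nat) :
    \prod_(k | k != j) g k (b k) = \prod_(k | k != j) g k (a k).
  by apply: eq_bigr => k kj; rewrite hb.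
rewrite (sub (fun k c => p k ^ c)) (sub (fun k c => above (p k) (a k) c)).
rewrite (sub (fun k c => totient (p k ^ c))).
rewrite (sub' (fun k c => p k ^ c)) (sub' (fun k c => above (p k) (a k) c)).
rewrite (sub' (fun k c => totient (p k ^ c))).
rewrite (eq_bigr (fun k => totient (p k ^ a k)) (fun k _ => above_full (p_prime k) (a_gt0 k))).
rewrite expn0 (_ : totient 1 = 1) // !mul1n.
by apply: zero_coord => //; apply: prod_totient_le.
Qed.

Lemma exists_zero_at_le (b : 'I_r -> nat) : gap_condition -> 0 < r ->
  (forall k, b k <= a k) -> exists j, nbhd p a (zero_at j) <= nbhd p a b.
Proof.
move=> K r0 ba; case: (pickP (fun j => b j < a j)) => [j0 bj0|full]; last first.
  exists (Ordinal r0); apply: nbhd_zero_at_le => // k _.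
  by apply/eqP; rewrite eqn_leq ba leqNgt full.
have [j bj jmax] := @arg_maxnP _ j0 (fun j => b j < a j) val bj0.
(* The first m coordinates are raised; j, the last deficient one, stays deficient while m <= j,
   which licenses each further raise. *)
pose c m (k : 'I_r) := if k < m then a k else b k.
have ca m k : c m k <= a k by rewrite /c; case: ifP.
have raised m : m <= j -> nbhd p a (c m) <= nbhd p a b.
  elim: m => [|m IH] mj; first by rewrite /nbhd /c.
  apply: leq_trans (IH (ltnW mj)).
  have mr : m < r by apply: leq_trans mj (ltnW (ltn_ord j)).
  apply: (@raise_nbhd _ _ (Ordinal mr) j) => //.
  - by rewrite /c [j < m]ltnNge (ltnW mj).
  - by move=> k km; rewrite /c ltnS leq_eqVlt -[k == m :> nat]/(k == Ordinal mr) (negbTE km).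
  by rewrite /c /= ltnS leqnn.
exists j; apply: leq_trans (raised j (leqnn j)).
apply: nbhd_zero_at_le => // k kj; rewrite /c; case: ltngtP => // [jk|/val_inj e]; last first.
  by rewrite e eqxx in kj.
apply/eqP; rewrite eqn_leq ba leqNgt; apply/negP => /jmax /=; lia.
Qed.

Lemma nbhd_zero_atE s t : s != t ->
  let N := \prod_(k | (k != s) && (k != t)) p k ^ a k in
  let F := \prod_(k | (k != s) && (k != t)) totient (p k ^ a k) in
  nbhd p a (zero_at s) =
  p t ^ a t * N + p s ^ a s * (totient (p t ^ a t) * F) - totient (p t ^ a t) * F.
Proof.
move=> st N F; have ts : t != s by rewrite eq_sym.
have E (g : 'I_r -> nat -> nat) : \prod_k g k (zero_at s k) =
    g s 0 * (g t (a t) * \prod_(k | (k != s) && (k != t)) g k (a k)).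
  rewrite (bigD1 s) //= (bigD1 t) //= /zero_at eqxx (negbTE ts).
  by do 2 congr (_ * _); apply: eq_bigr => k /andP[/negbTE -> _].
rewrite /nbhd (E (fun k c => p k ^ c)) (E (fun k c => above (p k) (a k) c)).
rewrite (E (fun k c => totient (p k ^ c))) expn0 (_ : totient 1 = 1) // !mul1n.
rewrite above_full //.
suff -> : \prod_(k | (k != s) && (k != t)) above (p k) (a k) (a k) = F by [].
by apply: eq_bigr => k _; apply: above_full.
Qed.

Lemma zero_at_cmp_small s t : p s < p t -> p s ^ a s <= p t ^ a t ->
  nbhd p a (zero_at t) <= nbhd p a (zero_at s).
Proof.
move=> pst qst; have st : s != t by apply: contraTneq pst => ->; rewrite ltnn.
have ts : t != s by rewrite eq_sym.
rewrite (nbhd_zero_atE st) (nbhd_zero_atE ts).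
have e (g : 'I_r -> nat) : \prod_(k | (k != t) && (k != s)) g k =
    \prod_(k | (k != s) && (k != t)) g k by apply: eq_bigl => k; rewrite andbC.
rewrite !e; have := prod_totient_le (fun k => (k != s) && (k != t)) a.
move: (\prod_(k | _) _) (\prod_(k | _) _) => F N FN.
move: qst; rewrite !totient_pfactor // (pow_predE _ (a_gt0 s)) (pow_predE _ (a_gt0 t)).
have x0 : 0 < p s ^ (a s).-1 by rewrite expn_gt0 p_gt0.
have y0 : 0 < p t ^ (a t).-1 by rewrite expn_gt0 p_gt0.
have [u eu] : exists u, p s = u.+1 by exists (p s).-1; rewrite prednK.
have [v ev] : exists v, p t = (u + v).+2.
  by exists (p t - (p s).+1); rewrite eu -!addSn -eu subnKC.
move: x0 y0; rewrite eu ev /=; move: (_ ^ _) (_ ^ _) => y x x0 y0 h.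
exact: nbhd_cmp_small.
Qed.

Lemma zero_at_cmp_large (s t : 'I_r) : gap_condition -> s < t -> p s < p t -> 1 < a t ->
  p t ^ a t <= p s ^ a s -> nbhd p a (zero_at t) <= nbhd p a (zero_at s).
Proof.
move=> K ltst pst at1 qst; have st : s != t by apply: contraTneq pst => ->; rewrite ltnn.
have ts : t != s by rewrite eq_sym.
rewrite (nbhd_zero_atE st) (nbhd_zero_atE ts).
have e (g : 'I_r -> nat) : \prod_(k | (k != t) && (k != s)) g k =
    \prod_(k | (k != s) && (k != t)) g k by apply: eq_bigl => k; rewrite andbC.
have {}K := K s t ltst.
rewrite (bigD1 s) //= (bigD1 t) //= [\prod_(k | k != s) _](bigD1 t) //= !mulnA in K.
move/rad_ineq: K; rewrite !e.
move: (\prod_(k | _) _) (\prod_(k | _) _) => F N FN.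
move: qst; rewrite !totient_pfactor // (pow_predE _ (a_gt0 s)) (pow_predE _ (a_gt0 t)).
have x0 : 0 < p s ^ (a s).-1 by rewrite expn_gt0 p_gt0.
have y0 : p t <= p t ^ (a t).-1.
  by rewrite -{1}[p t]expn1 leq_exp2l ?prime_gt1 //; lia.
have [u eu] : exists u, p s = u.+1 by exists (p s).-1; rewrite prednK.
have [v ev] : exists v, p t = (u + v).+2.
  by exists (p t - (p s).+1); rewrite eu -!addSn -eu subnKC.
move: x0 y0 FN; rewrite eu ev /=; move: (_ ^ _) (_ ^ _) => y x x0 y0 h FN.
exact: nbhd_cmp_large.
Qed.

Lemma zero_at_cmp_one s t : p s < p t -> a t = 1 ->
  p s * \prod_(k | (k != s) && (k != t)) p k <=
  (p t).-1 * \prod_(k | (k != s) && (k != t)) (p k).-1 ->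
  nbhd p a (zero_at t) <= nbhd p a (zero_at s).
Proof.
move=> pst at1 /rad_ineq h; have st : s != t by apply: contraTneq pst => ->; rewrite ltnn.
have ts : t != s by rewrite eq_sym.
rewrite (nbhd_zero_atE st) (nbhd_zero_atE ts).
have e (g : 'I_r -> nat) : \prod_(k | (k != t) && (k != s)) g k =
    \prod_(k | (k != s) && (k != t)) g k by apply: eq_bigl => k; rewrite andbC.
rewrite !e; move: (\prod_(k | _) _) (\prod_(k | _) _) h => F N.
rewrite at1 !totient_pfactor // expn1 muln1 (pow_predE _ (a_gt0 s)).
have x0 : 0 < p s ^ (a s).-1 by rewrite expn_gt0 p_gt0.
have [u eu] : exists u, p s = u.+1 by exists (p s).-1; rewrite prednK.
have [v ev] : exists v, p t = (u + v).+2.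
  by exists (p t - (p s).+1); rewrite eu -!addSn -eu subnKC.
move: x0; rewrite eu ev /=; move: (_ ^ _) => x x0 h.
exact: nbhd_cmp_one.
Qed.

End Minimum.

(** * Bounds on iterated minima *)

Lemma big_minn_leq (I : eqType) (s : seq I) (P : pred I) (f : I -> nat) d x :
  x \in s -> P x -> \big[minn/d]_(i <- s | P i) f i <= f x.
Proof.
elim: s => // i s IH; rewrite inE big_cons => /orP[/eqP <- ->|xs Px]; first exact: geq_minl.
by case: ifP => _; [apply: leq_trans (geq_minr _ _) _ | ]; apply: IH.
Qed.

Lemma leq_big_minn (I : eqType) (s : seq I) (P : pred I) (f : I -> nat) d m :
  m <= d -> (forall x, x \in s -> P x -> m <= f x) ->
  m <= \big[minn/d]_(i <- s | P i) f i.
Proof.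
move=> md h; rewrite big_seq_cond; elim/big_ind: _ => // [x y|i /andP[]]; last exact: h.
by rewrite leq_min => -> ->.
Qed.

(** * Inequalities between the primes *)

Section Conditions.

Variables (r : nat) (p : nat -> nat).
Hypothesis p_prime : forall i, i < r -> prime (p i).
Hypothesis p_incr : forall i, i.+1 < r -> p i < p i.+1.

Let q (i : 'I_r) := p i.
Let q_prime i : prime (q i). Proof. exact: p_prime. Qed.

Lemma p_mono i j : i < j -> j < r -> p i < p j.
Proof.
elim: j => // j IH; rewrite ltnS leq_eqVlt => /orP[/eqP -> jr|ij jr]; first exact: p_incr.
exact: ltn_trans (IH ij (ltnW jr)) (p_incr jr).
Qed.

Lemma p_ord_inj : injective q.
Proof.
move=> i j; rewrite /q => e; apply/val_inj; case: (ltngtP i j) => // h.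
  by have := p_mono h (ltn_ord j); rewrite e ltnn.
by have := p_mono h (ltn_ord i); rewrite e ltnn.
Qed.

(** Splitting off the factor i of the totient leaves 2(p_i - 1) <= p_i + p_j. *)
Lemma gap_of_half :
  \prod_(i < r) p i <= 2 * totient (\prod_(i < r) p i) -> gap_condition q.
Proof.
have -> : totient (\prod_(i < r) p i) = \prod_i (q i).-1.
  rewrite (eq_bigr (fun i => q i ^ 1)); last by move=> i _; rewrite expn1.
  rewrite (totient_prod_pow q_prime p_ord_inj (fun=> 1)).
  by apply: eq_bigr => i _; rewrite expn1 totient_prime.
move=> h i j ij; apply: leq_trans h _; rewrite (bigD1 i) //= mulnA leq_mul2r.
by have := p_mono ij (ltn_ord j); rewrite /q; lia.
Qed.

Lemma gap_of_ratio :
  (forall i, i.+1 < r -> r * totient (p i) <= totient (p i.+1)) -> gap_condition q.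
Proof.
move=> h i j ij.
have ratio k l : k < l -> l < r -> r * (p k).-1 <= (p l).-1.
  move=> kl lr; have k1r : k.+1 < r by apply: leq_ltn_trans lr.
  have := h k k1r; rewrite !totient_prime ?p_prime //; last exact: ltnW.
  move=> H; apply: leq_trans H _; case: (ltngtP k.+1 l) kl => // [kl _|-> //].
  by have := p_mono kl lr; lia.
have r0 : 0 < r by apply: leq_ltn_trans (ltn_ord i).
pose z := Ordinal r0.
have p0 : 1 < p 0 by apply/prime_gt1/p_prime.
have pi1 := prime_gt1 (q_prime i).
have rij := ratio i j ij (ltn_ord j).
have count_enum (T : pred 'I_r) : count T (index_enum _) = #|T|.
  by rewrite -size_filter cardE /enum_mem.
(* For the smallest prime, take N = r(p_0 - 1) + 1: the r - 1 other primes are at least N, in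
   particular N <= p_j, and p_0 <= N - (r - 1). *)
have [i0|i0] := posnP i.
  have H : ((r * (p 0).-1).+1 - r.-1) * \prod_(k | k != i) q k <=
      (r * (p 0).-1).+1 * \prod_(k | k != i) (q k).-1.
    have -> : r.-1 = count (fun k : 'I_r => k != i) (index_enum _).
      by rewrite count_enum cardC1 card_ord.
    apply: bernoulli_pred => k ki; have k0 : 0 < k by rewrite lt0n -i0.
    have := ratio 0 k k0 (ltn_ord k); have := prime_gt1 (q_prime k); rewrite /q; lia.
  rewrite (bigD1 i) //=; have yN : (r * (p 0).-1).+1 <= q j.
    by move: rij; rewrite i0 => rij; have := prime_gt1 (q_prime j); rewrite /q; lia.
  have xN : q i <= (r * (p 0).-1).+1 - r.-1.
    rewrite /q i0; move: p0 (r0); case: (p 0) => // u; case: (r) => // c u1 _.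
    rewrite /=; nia.
  rewrite -(leq_pmul2l (ltn0Sn (r * (p 0).-1))).
  move: H xN yN; move: (_.+1) (_.+1 - _) => N M H xN yN.
  rewrite [X in _ <= X]mulnCA; apply: leq_trans (leq_mul (leqnn _) H).
  rewrite !mulnA leq_mul2r; apply/orP; right; apply: leq_mul => //.
  by apply: leq_trans yN _; apply: leq_addl.
(* Otherwise p_0 is treated apart, by p_0 <= 2(p_0 - 1). The r - 2 primes besides p_0 and p_i are at
   least r + 1, which leaves Bernoulli's factor 3/(r + 1). *)
have zi : z != i by apply: contraTneq i0 => <-.
have H : (r.+1 - r.-2) * \prod_(k | (k != i) && (k != z)) q k <=
    r.+1 * \prod_(k | (k != i) && (k != z)) (q k).-1.
  have -> : r.-2 = count (fun k : 'I_r => (k != i) && (k != z)) (index_enum _).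
    rewrite count_enum; have := cardC (pred2 i z); rewrite card2 eq_sym zi card_ord.
    rewrite (eq_card (_ : predC (pred2 i z) =i (fun k : 'I_r => (k != i) && (k != z)))).
      by move=> e; rewrite -[in LHS]e.
    by move=> k; rewrite !inE negb_or.
  apply: bernoulli_pred => k /andP[_ kz]; have k0 : 0 < k by rewrite lt0n.
  have := ratio 0 k k0 (ltn_ord k); have := prime_gt1 (q_prime k); rewrite /q.
  by move: p0; case: (p 0) => // u; case: (p k) => // c; rewrite /= => *; nia.
rewrite (bigD1 i) //= (bigD1 z) //= [\prod_(k | k != i) _](bigD1 z) //=.
have ri : r.+1 <= q i.
  have := ratio 0 i i0 (ltn_ord i).
  rewrite /q; move: p0 pi1; rewrite /q; case: (p 0) => // u; case: (p i) => // c.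
  by rewrite /= => *; nia.
have r3 : 2 < r by have := ltn_ord j; lia.
have h1 : q z <= 2 * (q z).-1 by rewrite /q /=; lia.
have h2 : 2 * r.+1 * q i <= 3 * (q i + q j).
  move: rij ri; rewrite /q; move: (p i) (p j) => x y rij ri; nia.
have {}H : 3 * \prod_(k | (k != i) && (k != z)) q k <=
    r.+1 * \prod_(k | (k != i) && (k != z)) (q k).-1.
  by apply: leq_trans H; rewrite leq_mul2r; apply/orP; right; lia.
move: (\prod_(k | _) _) (\prod_(k | _) _) H => Q R H.
rewrite -(leq_pmul2l (_ : 0 < 2 * r.+1)) //.
have h3 : 3 * (q i + q j) * (q z * R) <= (q i + q j) * (2 * (q z).-1) * (r.+1 * Q).
  by apply: leq_trans (leq_mul (leq_mul (leqnn (q i + q j)) h1) H); apply: eq_leq; ring.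
by apply: leq_of_excess (leq_trans (leq_mul h2 (leqnn (q z * R))) h3); ring.
Qed.

(** Shifting the index by one pairs each prime on the left with the next on the right, and p_k <=
    p_(k+1) - 1. *)
Lemma prod_pred_telescope : 2 <= r -> forall s t : 'I_r, val s = 0 -> val t = r.-1 ->
  q s * \prod_(k | (k != s) && (k != t)) q k <=
  (q t).-1 * \prod_(k | (k != s) && (k != t)) (q k).-1.
Proof.
move=> r2 s t es et; have st : t != s.
  by apply/eqP => e; move: es; rewrite -e et; lia.
have e1 : \prod_(k < r) p k = q s * (q t * \prod_(k | (k != s) && (k != t)) q k).
  by rewrite (bigD1 s) //= (bigD1 t).
have e2 : \prod_(k < r) (p k).-1 =
    (q s).-1 * ((q t).-1 * \prod_(k | (k != s) && (k != t)) (q k).-1).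
  by rewrite (bigD1 s) //= (bigD1 t).
have s1 := prime_gt1 (q_prime s); have t1 := prime_gt1 (q_prime t).
have s0 : 0 < (q s).-1 by lia.
(* The multipliers complete the products to all indices, so that the last and the first factor can
   be split off. *)
rewrite -(leq_pmul2l s0) -e2 -(leq_pmul2l (ltnW t1)).
have -> : q t * ((q s).-1 * (q s * \prod_(k | (k != s) && (k != t)) q k)) =
    (q s).-1 * \prod_(k < r) p k by rewrite e1; ring.
have er : r = r.-1.+1 by lia.
have -> : \prod_(k < r) p k = (\prod_(0 <= k < r.-1) p k) * q t.
  by rewrite -(big_mkord xpredT) {1}er big_nat_recr //= /q et.
have -> : \prod_(k < r) (p k).-1 = (q s).-1 * \prod_(0 <= k < r.-1) (p k.+1).-1.
  by rewrite -(big_mkord xpredT (fun k => (p k).-1)) {1}er big_nat_recl //= /q es.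
rewrite [_ * q t]mulnC mulnCA !leq_mul2l.
do 2![apply/orP; right]; rewrite !big_mkord; apply: leq_prod => k _.
by have := @p_incr k; have := ltn_ord k; lia.
Qed.

End Conditions.

(* Indices are 0-based: p_1,...,p_r are p 0,...,p (r-1). C_n is 'Z_n. *)
Theorem theorem1p3 (n r t : nat) (p a : nat -> nat)
  (hr : 2 <= r)
  (hp : forall i, i < r -> prime (p i))
  (ha : forall i, i < r -> 0 < a i)
  (hinc : forall i, i.+1 < r -> p i < p i.+1)
  (hn : n = \prod_(i < r) p i ^ a i)
  (hcond : (\prod_(i < r) p i <= 2 * totient (\prod_(i < r) p i))
           \/ (forall i, i.+1 < r -> r * totient (p i) <= totient (p i.+1)))
  (ht1 : 1 <= t < r)
  (htmax : forall j, 1 <= j < r -> a j <= a t)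
  (htlast : forall s, t < s < r -> ~ (forall j, 1 <= j < r -> a j <= a s)) :
  pg_mindeg 'Z_n =
  \big[minn/#|'Z_n|]_(t <= s < r) pg_deg (inZp (p s ^ a s) : 'Z_n).
Proof.
pose q (i : 'I_r) := p i; pose e (i : 'I_r) := a i.
have q_prime i : prime (q i) by apply: hp.
have e_gt0 i : 0 < e i by apply: ha.
have q_inj : injective q by apply: p_ord_inj.
have K : gap_condition q by case: hcond; [exact: gap_of_half | exact: gap_of_ratio].
have r0 : 0 < r := ltnW hr.
have en : n = \prod_i q i ^ e i by [].
have n1 : 1 < n.
  rewrite en (bigD1 (Ordinal r0)) //=; apply: (@leq_trans (q (Ordinal r0) ^ e (Ordinal r0))).
    by rewrite -(exp1n (e (Ordinal r0))) ltn_exp2r ?prime_gt1.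
  by rewrite leq_pmulr // prodn_gt0 // => i; rewrite expn_gt0 prime_gt0.
case/andP: ht1 => t0 tr; pose T := Ordinal tr.
have to_t (s : 'I_r) : s < T -> nbhd q e (zero_at e T) <= nbhd q e (zero_at e s).
  move=> sT; have pst : q s < q T by apply: (p_mono hinc).
  have [qle|qlt] := leqP (q s ^ e s) (q T ^ e T); first exact: zero_at_cmp_small.
  (* For 0 < s < t, both p_s < p_t and a_s <= a_t, so p_s^a_s could not exceed p_t^a_t. *)
  have s0 : val s = 0.
    apply/eqP; apply: contraTT qlt; rewrite -lt0n -leqNgt => s0.
    apply: (@leq_trans (q s ^ e T)); last by rewrite leq_exp2r // ltnW.
    by rewrite leq_exp2l ?prime_gt1 // htmax // s0 ltn_ord.
  have [at1|at1] := leqP (e T) 1; last exact: zero_at_cmp_large (ltnW qlt).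
  have eT : e T = 1 by apply/eqP; rewrite eqn_leq at1 e_gt0.
  apply: zero_at_cmp_one => //; apply: prod_pred_telescope => //=.
  (* Since a_t = 1 is maximal, every exponent after the first is 1, and the last index would
     contradict the choice of t. *)
  apply/eqP; rewrite -eqSS prednK // eqn_leq tr leqNgt /=; apply/negP => ltr.
  apply: (htlast r.-1); first by lia.
  by move=> j jr; apply: leq_trans (htmax _ jr) _; apply: leq_trans at1 _; apply: ha; lia.
have degs (s : 'I_r) : (pg_deg (inZp (p s ^ a s) : 'Z_n)).+1 = nbhd q e (zero_at e s).
  apply: (pg_deg_Zn q_prime q_inj en n1); first by move=> k; rewrite /zero_at; case: ifP.
  rewrite order_Zn //=.
  rewrite Zp_cast // gcdn_modr en (bigD1 s) //= gcdnC gcdnMr mulKn ?expn_gt0 ?prime_gt0 //.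
  rewrite [RHS](bigD1 s) //= /zero_at eqxx expn0 mul1n; apply: eq_bigr => k /negbTE -> //.
have min_deg (x : 'Z_n) :
    exists2 s : 'I_r, t <= s & pg_deg (inZp (p s ^ a s) : 'Z_n) <= pg_deg x.
  pose b (i : 'I_r) := logn (q i) #[x]%g.
  have xn : #[x]%g %| \prod_i q i ^ e i
    by rewrite -en; have := order_dvdG (in_setT x); rewrite cardsT card_ord Zp_cast.
  have ba k : b k <= e k.
    by rewrite -(logn_prod_pow q_prime q_inj e k) /b dvdn_leq_log // -?en // ltnW.
  have ex : #[x]%g = \prod_i q i ^ b i by apply: (dvd_prod_pow q_prime q_inj xn).
  have dx := pg_deg_Zn q_prime q_inj en n1 ba ex.
  have [j jx] := exists_zero_at_le q_prime e_gt0 K r0 ba.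
  have [tj|jt] := leqP t j; first by exists j; rewrite // -ltnS degs dx.
  exists T => //; rewrite -ltnS degs dx; apply: leq_trans jx; exact: to_t.
(* In both directions the default value of the minimum is harmless, being at least any degree. *)
apply/eqP; rewrite eqn_leq; apply/andP; split.
  apply: leq_big_minn => [|s].
    exact: leq_trans (big_minn_leq _ _ (mem_index_enum 0%R) isT) (max_card _).
  rewrite mem_index_iota => /andP[ts sr] _; exact: big_minn_leq.
apply: leq_big_minn => [|x _ _].
  apply: leq_trans (big_minn_leq _ _ (_ : t \in _) isT) (max_card _).
  by rewrite mem_index_iota leqnn.
have [s ts sx] := min_deg x; apply: leq_trans sx.
apply: (big_minn_leq (fun s => pg_deg (inZp (p s ^ a s) : 'Z_n))) => //.
by rewrite mem_index_iota ts ltn_ord.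
Qed.
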